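(* Let $\mathbb{K}$ be a unital commutative ring. In the completed free dendriform algebra on one generator $x$ over $\mathbb{K}$, the inverse for composition of the exponential series $E(x):=e(x)-1=\sum_{n\ge1}x^{\prec n}$ is the series $$L(x):=x\prec\big(1-x+x^2-x^3+\cdots+(-1)^nx^n+\cdots\big),$$ that is, $E(L(x))=x=L(E(x))$.
   Context: A dendriform algebra over $\mathbb{K}$ is a $\mathbb{K}$-module $A$ with two bilinear operations $\prec,\succ:A\otimes A\to A$ such that $(x\prec y)\prec z=x\prec(y\prec z)+x\prec(y\succ z)$, $(x\succ y)\prec z=x\succ(y\prec z)$, $(x\prec y)\succ z+(x\succ y)\succ z=x\succ(y\succ z)$. The product $xy:=x\prec y+x\succ y$ is associative, and $x^n$ denotes the $n$-th power for it. Let $V=\mathbb{K}x$; $Dend(V)=\bigoplus_{n\ge 1}Dend_n\otimes V^{\otimes n}$ is the free dendriform algebra on $V$, graded by degree, and $Dend(V)^{\wedge}=\prod_{n\ge 1}Dend_n\otimes V^{\otimes n}$ its completion. A unit $1$ is adjoined by $u\prec 1=u$, $1\prec u=0$, $u\succ 1=0$, $1\succ u=u$ for $u\in Dend(V)^{\wedge}$ ($1\prec 1$, $1\succ 1$ undefined); thus $L(x)=x+\sum_{n\ge1}(-1)^n\,x\prec x^n$. Powers: $x^{\prec 1}=x$, $x^{\prec n}=x\prec(x^{\prec n-1})$. For a series $F(x)\in Dend(V)^{\wedge}$ and $z\in Dend(V)^{\wedge}$, $F(z)$ is the result of substituting $z$ for $x$ (the image of $F$ under the continuous dendriform endomorphism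 sending $x$ to $z$). *)

(* Defs.v *)
From HB Require Import structures.
From mathcomp Require Import all_boot all_order all_algebra.
From mathcomp Require Import boolp functions.

Set Implicit Arguments.
Unset Strict Implicit.
Unset Printing Implicit Defensive.

Import GRing.Theory.
Local Open Scope ring_scope.

Record is_dendriform (K : comPzRingType) (A : lmodType K)
    (lt gt : A -> A -> A) : Prop := IsDendriform {
  lt_linearr : forall x, linear (lt x);
  lt_linearl : forall y, linear (lt ^~ y);
  gt_linearr : forall x, linear (gt x);
  gt_linearl : forall y, linear (gt ^~ y);
  dend_ax1 : forall x y z, lt (lt x y) z = lt x (lt y z) + lt x (gt y z);
  dend_ax2 : forall x y z, lt (gt x y) z = gt x (lt y z);
  dend_ax3 : forall x y z, gt (lt x y) z + gt (gt x y) z = gt x (gt y z) }.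

Record dendType (K : comPzRingType) := DendType {
  dend_sort :> lmodType K;
  lprec : dend_sort -> dend_sort -> dend_sort;
  lsucc : dend_sort -> dend_sort -> dend_sort;
  dendP : is_dendriform lprec lsucc }.

Record dend_morphism (K : comPzRingType) (A B : dendType K) (f : A -> B) : Prop :=
  DendMorphism {
  morph_linear : linear f;
  morph_prec : forall x y, f (lprec x y) = lprec (f x) (f y);
  morph_succ : forall x y, f (lsucc x y) = lsucc (f x) (f y) }.

Section Linear.
Variables (K : pzRingType) (A B : lmodType K) (f : A -> B).
Hypothesis fL : linear f.

Lemma lin_add x y : f (x + y) = f x + f y.
Proof. by have := fL 1 x y; rewrite !scale1r. Qed.

Lemma lin0 : f 0 = 0.
Proof. by apply: (addIr (f 0)); rewrite -lin_add !add0r. Qed.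

Lemma lin_scale a x : f (a *: x) = a *: f x.
Proof. by rewrite -[a *: x]addr0 fL lin0 addr0. Qed.

Lemma lin_sum I (r : seq I) P (F : I -> A) :
  f (\sum_(i <- r | P i) F i) = \sum_(i <- r | P i) f (F i).
Proof. exact: (big_morph f lin_add lin0). Qed.

End Linear.

(* Planar binary trees.  [Node l r] is the grafting l \/ r and [Leaf] is the
   tree without internal vertex. *)

Inductive tree := Leaf | Node of tree & tree.

Fixpoint tree_eqb (s t : tree) : bool :=
  match s, t with
  | Leaf, Leaf => true
  | Node l r, Node l' r' => tree_eqb l l' && tree_eqb r r'
  | _, _ => false
  end.

Lemma tree_eqbP : Equality.axiom tree_eqb.
Proof.
elim=> [|l IHl r IHr] [|l' r'] /=; try by constructor.
by apply: (iffP andP) => [[/IHl-> /IHr->]|[<- <-]] //; split; [exact/IHl|exact/IHr].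
Qed.
HB.instance Definition _ := hasDecEq.Build tree tree_eqbP.

(* The pair (l, r) stands for the tree [Node l r]: this is the type of the
   trees with at least one internal vertex. *)
Definition dtree := (tree * tree)%type.
Definition node (t : dtree) : tree := Node t.1 t.2.

Fixpoint deg (t : tree) : nat :=
  if t is Node l r then (deg l + deg r).+1 else 0%N.
Definition ddeg (t : dtree) : nat := deg (node t).

(* Dend_n has the trees with n internal vertices as a basis, Leaf being the
   adjoined unit, and the operations are (Loday)
     (l \/ r) < s = l \/ (r * s),   s > (l \/ r) = (s * l) \/ r,
     s * t = s < t + s > t.
   [cuts t] lists the pairs (a, b) such that t occurs in a * b; the coefficient
   of t in a * b is the multiplicity of (a, b) in [cuts t], see umul_delta,
   dprec_ddelta and dsucc_ddelta. *)
Fixpoint cuts (t : tree) : seq (tree * tree) :=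
  if t is Node l r then
    [seq (Node l p.1, p.2) | p <- cuts r] ++ [seq (p.1, Node p.2 r) | p <- cuts l]
  else [:: (Leaf, Leaf)].

(* The value at b of the monomial given by a tree, in a dendriform algebra
   with adjoined unit None:  (l \/ r)(b) = (l(b) > b) < r(b). *)

Section Monomials.
Variables (K : comPzRingType) (B : dendType K).

Definition precu (x : B) (o : option B) : B := if o is Some y then lprec x y else x.
Definition succu (o : option B) (y : B) : B := if o is Some x then lsucc x y else y.

Fixpoint umonom (b : B) (t : tree) : option B :=
  if t is Node l r then Some (precu (succu (umonom b l) b) (umonom b r)) else None.

Definition monom (b : B) (t : dtree) : B :=
  precu (succu (umonom b t.1) b) (umonom b t.2).

End Monomials.

Fixpoint trees_height (n : nat) : seq tree :=
  if n is n'.+1 then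
    Leaf :: [seq Node l r | l <- trees_height n', r <- trees_height n']
  else [:: Leaf].

(* all trees t with 1 <= deg t <= n, see mem_dtrees *)
Definition dtrees (n : nat) : seq dtree :=
  [seq t <- [seq (l, r) | l <- trees_height n, r <- trees_height n] | (ddeg t <= n)%N].

Arguments trees_height : simpl never.

Lemma trees_heightS n :
  trees_height n.+1
  = Leaf :: [seq Node l r | l <- trees_height n, r <- trees_height n].
Proof. by []. Qed.

Fixpoint height (t : tree) : nat :=
  if t is Node l r then (maxn (height l) (height r)).+1 else 0%N.

Lemma mem_trees_height n t : (t \in trees_height n) = (height t <= n)%N.
Proof.
elim: n t => [|n IHn] t; first by rewrite inE; case: t => [|l r]; apply/eqP.
rewrite trees_heightS inE; case: t => [|l r] //.
rewrite /= ltnS geq_max -!IHn.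
apply/allpairsP/andP => [[[a b] /= [ha hb [-> ->]]] //|[hl hr]].
by exists (l, r).
Qed.

Lemma height_deg t : (height t <= deg t)%N.
Proof.
elim: t => //= l IHl r IHr; rewrite ltnS geq_max.
by rewrite (leq_trans IHl (leq_addr _ _)) (leq_trans IHr (leq_addl _ _)).
Qed.

Lemma mem_dtrees n t : (t \in dtrees n) = (ddeg t <= n)%N.
Proof.
rewrite mem_filter; case: leqP => //= le_tn.
case: t le_tn => l r; rewrite /ddeg /= => le_tn.
apply/allpairsP; exists (l, r); split=> //=; rewrite mem_trees_height.
  by rewrite (leq_trans (height_deg _)) // ltnW // (leq_ltn_trans _ le_tn) // leq_addr.
by rewrite (leq_trans (height_deg _)) // ltnW // (leq_ltn_trans _ le_tn) // leq_addl.
Qed.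

Lemma uniq_trees_height n : uniq (trees_height n).
Proof.
elim: n => // n IHn; rewrite trees_heightS; apply/andP; split; first by apply/allpairsP => -[[a b] [_ _]].
by apply: allpairs_uniq => // -[a b] [c d] _ _ [-> ->].
Qed.

Lemma uniq_dtrees n : uniq (dtrees n).
Proof.
apply: filter_uniq; apply: allpairs_uniq; rewrite ?uniq_trees_height //.
by move=> [a b] [c d] _ _.
Qed.

Fixpoint tmul (a : tree) : tree -> seq tree :=
  fix tmula (b : tree) : seq tree :=
  match a, b with
  | Leaf, _ => [:: b]
  | _, Leaf => [:: a]
  | Node l0 r0, Node l1 r1 =>
      [seq Node l0 u | u <- tmul r0 b] ++ [seq Node u r1 | u <- tmula l1]
  end.

Lemma tmul_Node l0 r0 l1 r1 :
  tmul (Node l0 r0) (Node l1 r1) =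
  [seq Node l0 u | u <- tmul r0 (Node l1 r1)]
  ++ [seq Node u r1 | u <- tmul (Node l0 r0) l1].
Proof. by []. Qed.

Lemma tmul1t t : tmul Leaf t = [:: t]. Proof. by case: t. Qed.
Lemma tmult1 t : tmul t Leaf = [:: t]. Proof. by case: t. Qed.

Lemma deg_tmul a b u : u \in tmul a b -> deg u = (deg a + deg b)%N.
Proof.
elim: a b u => [|l0 _ r0 IHr] b u; first by rewrite tmul1t inE => /eqP->.
elim: b u => [|l1 IHl r1 _] u; first by rewrite tmult1 inE addn0 => /eqP->.
rewrite tmul_Node mem_cat => /orP[] /mapP[v vin ->] /=.
  by rewrite (IHr _ _ vin) /= addnA.
by rewrite (IHl _ vin) /= !addSn !addnS addnA.
Qed.

Lemma deg_cuts t p : p \in cuts t -> (deg p.1 + deg p.2)%N = deg t.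
Proof.
elim: t p => [|l IHl r IHr] p; first by rewrite inE => /eqP->.
rewrite mem_cat => /orP[] /mapP[q qin ->] /=.
  by rewrite -(IHr _ qin) addSn addnA.
by rewrite -(IHl _ qin) addnS addnA.
Qed.

Section MonomialProduct.
Variables (K : comPzRingType) (B : dendType K).
Implicit Types (b x y z : B) (o : option B).

Lemma precu_linear x y o : precu (x + y) o = precu x o + precu y o.
Proof. by case: o => //= z; rewrite (lin_add (lt_linearl (dendP B) z)). Qed.

Lemma precu_succu o x o' : precu (succu o x) o' = succu o (precu x o').
Proof. by case: o o' => [y|] [z|] //=; rewrite (dend_ax2 (dendP B)). Qed.

Lemma monom_mul b s t : 
  (forall z, \sum_(u <- tmul s t) precu z (umonom b u)
             = precu (precu z (umonom b s)) (umonom b t)) /\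
  (forall z, \sum_(u <- tmul s t) succu (umonom b u) z
             = succu (umonom b s) (succu (umonom b t) z)).
Proof.
have D := dendP B.
elim: s t => [|l0 _ r0 IHr] t; first by rewrite tmul1t; split=> z; rewrite big_seq1.
elim: t => [|l1 IHl r1 _]; first by rewrite tmult1; split=> z; rewrite big_seq1.
pose x := monom b (l0, r0); pose y := monom b (l1, r1).
have prec_lin z (r : seq tree) F :
    \sum_(u <- r) lprec z (F u) = lprec z (\sum_(u <- r) F u :> B).
  by rewrite (lin_sum (lt_linearr D z)).
have succ_lin z (r : seq tree) F :
    \sum_(u <- r) lsucc (F u) z = lsucc (\sum_(u <- r) F u :> B) z.
  by rewrite (lin_sum (gt_linearl D z)).
have precu_sum o (r : seq tree) (F : tree -> B) :
    \sum_(u <- r) precu (F u) o = precu (\sum_(u <- r) F u) o.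
  by case: o => //= z; rewrite (lin_sum (lt_linearl D z)).
have xy : \sum_(u <- tmul r0 (Node l1 r1)) monom b (l0, u) = lprec x y.
  by rewrite (IHr _).1.
have yx : \sum_(u <- tmul (Node l0 r0) l1) monom b (u, r1) = lsucc x y.
  by rewrite /monom precu_sum IHl.2 precu_succu.
split=> z; rewrite tmul_Node big_cat !big_map /=.
  rewrite !prec_lin -[X in lprec z X + _]/(\sum_(u <- _) monom b (l0, u)) xy.
  by rewrite -[X in _ + lprec z X]/(\sum_(u <- _) monom b (u, r1)) yx -(dend_ax1 D).
rewrite !succ_lin -[X in lsucc X z + _]/(\sum_(u <- _) monom b (l0, u)) xy.
by rewrite -[X in _ + lsucc X z]/(\sum_(u <- _) monom b (u, r1)) yx (dend_ax3 D).
Qed.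

Lemma monom_prec b s t :
  \sum_(u <- tmul s.2 (node t)) monom b (s.1, u) = lprec (monom b s) (monom b t).
Proof. by rewrite (monom_mul _ _ _).1. Qed.

Lemma monom_succ b s t :
  \sum_(u <- tmul (node s) t.1) monom b (u, t.2) = lsucc (monom b s) (monom b t).
Proof.
rewrite -[RHS]/(succu (umonom b (node s))
  (precu (succu (umonom b t.1) b) (umonom b t.2))).
rewrite -precu_succu -(monom_mul b (node s) t.1).2 /monom.
case: (umonom b t.2) => //= z.
by rewrite (lin_sum (lt_linearl (dendP B) z)).
Qed.

End MonomialProduct.

Lemma monom_morph (K : comPzRingType) (A B : dendType K) (f : A -> B) a t :
  dend_morphism f -> f (monom a t) = monom (f a) t.
Proof.
move=> fM.
have fp x o : f (precu x o) = precu (f x) (omap f o).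
  by case: o => //= y; rewrite (morph_prec fM).
have fs o x : f (succu o x) = succu (omap f o) (f x).
  by case: o => //= y; rewrite (morph_succ fM).
have fu s : omap f (umonom a s) = umonom (f a) s.
  by elim: s => //= l IHl r IHr; rewrite fp fs IHl IHr.
by rewrite /monom fp fs !fu.
Qed.

Section Series.
Variable K : comPzRingType.

(* A formal series is the family of its coefficients on trees, K^o being K as a
   module over itself.  [dser] is the completion (the product over n >= 1 of the
   degree n parts) of the free dendriform algebra [Dend] constructed below, and
   [ser] is [dser] with a unit adjoined.  That [Dend] is free on one generator is
   Dend_free. *)
Definition ser := tree -> K^o.
Definition dser := dtree -> K^o.

HB.instance Definition _ := GRing.Lmodule.on ser.
HB.instance Definition _ := GRing.Lmodule.on dser.

Definition aug (f : dser) : ser := fun t => if t is Node l r then f (l, r) else 0.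
Definition uone : ser := fun t => if t is Leaf then 1 else 0.
Definition umul (f g : ser) : ser := fun t => \sum_(p <- cuts t) f p.1 * g p.2.
Definition upow (f : ser) (n : nat) : ser := iter n (umul f) uone.

(* u < v and v > u, where v may involve the unit but u may not; u < 1 = u and
   1 > u = u are uprec1 and usucc1. *)
Definition uprec (u : dser) (v : ser) : dser :=
  fun t => umul (fun s => u (t.1, s)) v t.2.
Definition usucc (v : ser) (u : dser) : dser :=
  fun t => umul v (fun s => u (s, t.2)) t.1.

Definition dprec (f g : dser) : dser := uprec f (aug g).
Definition dsucc (f g : dser) : dser := usucc (aug f) g.

Definition delta (t : tree) : ser := fun s => (s == t)%:R.
Definition ddelta (t : dtree) : dser := fun s => (s == t)%:R.
Definition Xser : dser := ddelta (Leaf, Leaf).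

(* The sums of u_n over n >= 0, resp. n >= 1, for families such that u_n has no
   term of degree < n (see usumE and dsumE); uorder_upow and order_lpow show that
   the families below are such. *)
Definition usum (u : nat -> ser) : ser :=
  fun t => \sum_(0 <= n < (deg t).+1) u n t.
Definition dsum (u : nat -> dser) : dser :=
  fun t => \sum_(1 <= n < (ddeg t).+1) u n t.

(* x < (x < (... < x)) with n factors, for n >= 1; the value at n = 0 is junk. *)
Definition lpow (f : dser) (n : nat) : dser := iter n.-1 (dprec f) f.

Definition Eser : dser := dsum (lpow Xser).
Definition Lser : dser := uprec Xser (usum (fun n => (-1) ^+ n *: upow (aug Xser) n)).


Lemma serDE (f g : ser) t : (f + g) t = f t + g t. Proof. by []. Qed.
Lemma serZE a (f : ser) t : (a *: f) t = a * f t. Proof. by []. Qed.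
Lemma dserDE (f g : dser) t : (f + g) t = f t + g t. Proof. by []. Qed.
Lemma dserZE a (f : dser) t : (a *: f) t = a * f t. Proof. by []. Qed.
Lemma ser_sumE I (r : seq I) P (f : I -> ser) t :
  (\sum_(i <- r | P i) f i) t = \sum_(i <- r | P i) f i t.
Proof. by elim/big_rec2: _ => // i x y _ <-. Qed.
Lemma dser_sumE I (r : seq I) P (f : I -> dser) t :
  (\sum_(i <- r | P i) f i) t = \sum_(i <- r | P i) f i t.
Proof. by elim/big_rec2: _ => // i x y _ <-. Qed.

Lemma umul_Node f g l r :
  umul f g (Node l r) = umul (fun s => f (Node l s)) g r
                        + umul f (fun s => g (Node s r)) l.
Proof. by rewrite /umul /= big_cat !big_map. Qed.

Lemma umul_linearr f : linear (umul f).
Proof.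
move=> a g h; apply/funext => t; rewrite serDE serZE /umul mulr_sumr -big_split.
by apply: eq_bigr => p _ /=; rewrite serDE serZE mulrDr mulrCA.
Qed.

Lemma umul_linearl g : linear (umul^~ g).
Proof.
move=> a f h; apply/funext => t; rewrite serDE serZE /umul mulr_sumr -big_split.
by apply: eq_bigr => p _ /=; rewrite serDE serZE mulrDl mulrA.
Qed.

Lemma umul_exchange f h (G : tree -> tree -> K^o) l r :
  umul (fun a => umul f (fun b => G b a) l) h r
  = umul f (fun b => umul (G b) h r) l.
Proof.
rewrite /umul; under eq_bigr do rewrite mulr_suml.
rewrite exchange_big; apply: eq_bigr => p _ /=; rewrite mulr_sumr.
by apply: eq_bigr => q _; rewrite mulrA.
Qed.

Lemma umulA : associative umul.
Proof.
move=> f g h; apply/funext => t; elim: t f g h => [|l IHl r IHr] f g h.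
  by rewrite /umul /= !big_seq1 /= mulrA.
rewrite !umul_Node IHr.
rewrite (_ : (fun s => umul f g (Node l s))
  = (umul (fun s => f (Node l s)) g : ser) + (fun s => umul f (fun b => g (Node b s)) l)); last first.
  by apply/funext => s; rewrite umul_Node.
have := umul_linearl h 1 (umul (fun s => f (Node l s)) g)
  (fun s => umul f (fun b => g (Node b s)) l).
rewrite !scale1r => ->; rewrite serDE umul_exchange -IHl -addrA; congr (_ + _).
rewrite (_ : (fun s => umul g h (Node s r))
  = ((fun b => umul (fun s => g (Node b s)) h r) : ser)
    + (umul g (fun b => h (Node b r)))); last first.
  by apply/funext => s; rewrite umul_Node.
have := umul_linearr f 1 (fun b => umul (fun s => g (Node b s)) h r)
  (umul g (fun b => h (Node b r))).
by rewrite !scale1r => ->.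
Qed.

Lemma umul1r f : umul uone f = f.
Proof.
apply/funext => t; elim: t f => [|l IHl r IHr] f; first by rewrite /umul big_seq1 mul1r.
rewrite umul_Node IHl [X in X + _](_ : _ = 0) ?add0r //.
by rewrite /umul big1 // => p _; rewrite mul0r.
Qed.

Lemma umulr1 f : umul f uone = f.
Proof.
apply/funext => t; elim: t f => [|l IHl r IHr] f; first by rewrite /umul big_seq1 mulr1.
rewrite umul_Node IHr [X in _ + X](_ : _ = 0) ?addr0 //.
by rewrite /umul big1 // => p _; rewrite mulr0.
Qed.

Lemma aug_linear : linear aug.
Proof. by move=> a f g; apply/funext => -[|l r] //; rewrite serDE serZE mulr0 addr0. Qed.

Lemma aug_mul f g : umul (aug f) (aug g) = aug (dprec f g + dsucc f g).
Proof.
apply/funext => -[|l r]; first by rewrite /umul big_seq1 mulr0.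
by rewrite umul_Node.
Qed.

Lemma uprec1 f : uprec f uone = f.
Proof. by apply/funext => -[l r]; rewrite /uprec umulr1. Qed.

Lemma usucc1 f : usucc uone f = f.
Proof. by apply/funext => -[l r]; rewrite /usucc umul1r. Qed.

Lemma uprecA f g h : uprec (uprec f g) h = uprec f (umul g h).
Proof. by apply/funext => -[l r]; rewrite /uprec umulA. Qed.

Lemma usuccA f g h : usucc f (usucc g h) = usucc (umul f g) h.
Proof. by apply/funext => -[l r]; rewrite /usucc -umulA. Qed.

Lemma uprec_usucc f g h : uprec (usucc f g) h = usucc f (uprec g h).
Proof.
apply/funext => -[l r]; rewrite /uprec /usucc /=.
exact: (umul_exchange f h (fun b a => g (b, a))).
Qed.

Lemma uprec_linearr f : linear (uprec f).
Proof. by move=> a g h; apply/funext => t; rewrite /uprec umul_linearr. Qed.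

Lemma usucc_linearl g : linear (usucc^~ g).
Proof. by move=> a f h; apply/funext => t; rewrite /usucc umul_linearl. Qed.

Lemma uprec_linearl g : linear (uprec^~ g).
Proof.
move=> a f h; apply/funext => t.
by have /(congr1 (fun F : ser => F t.2)) :=
  umul_linearl g a (fun s => f (t.1, s)) (fun s => h (t.1, s)).
Qed.

Lemma usucc_linearr f : linear (usucc f).
Proof.
move=> a g h; apply/funext => t.
by have /(congr1 (fun F : ser => F t.1)) :=
  umul_linearr f a (fun s => g (s, t.2)) (fun s => h (s, t.2)).
Qed.

Lemma dprec_linearr f : linear (dprec f).
Proof. by move=> a g h; rewrite /dprec aug_linear uprec_linearr. Qed.

Lemma dsucc_linearl g : linear (dsucc^~ g).
Proof. by move=> a f h; rewrite /dsucc aug_linear usucc_linearl. Qed.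

Lemma dser_dendriform : is_dendriform dprec dsucc.
Proof.
split=> [f a g h|g a f h|f a g h|g a f h|f g h|f g h|f g h].
- exact: dprec_linearr.
- exact: uprec_linearl.
- exact: usucc_linearr.
- exact: dsucc_linearl.
- by rewrite /dprec uprecA aug_mul -(lin_add (dprec_linearr f)).
- exact: uprec_usucc.
- by rewrite -(lin_add (dsucc_linearl h)) /dsucc usuccA aug_mul.
Qed.

Definition dendhat : dendType K := DendType dser_dendriform.


Lemma delta_Nodel l0 r0 l s : delta (Node l0 r0) (Node l s) = (l == l0)%:R * delta r0 s.
Proof. by rewrite /delta -natrM mulnb. Qed.

Lemma delta_Noder l0 r0 s r : delta (Node l0 r0) (Node s r) = (r == r0)%:R * delta l0 s.
Proof. by rewrite /delta -natrM mulnb andbC. Qed.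

Lemma umul_delta a b : umul (delta a) (delta b) = \sum_(u <- tmul a b) delta u.
Proof.
apply/funext => t; elim: t a b => [|l IHl r IHr] a b.
  rewrite /umul big_seq1 ser_sumE; case: a b => [|l0 r0] [|l1 r1].
  - by rewrite big_seq1 mulr1.
  - by rewrite big_seq1 mulr0.
  - by rewrite big_seq1 mul0r.
  - rewrite mul0r big1_seq // => u /andP[_]; rewrite tmul_Node mem_cat.
    by case/orP => /mapP[v _ ->].
have d1 : delta Leaf = uone by apply/funext => -[].
case: a b => [|l0 r0] [|l1 r1]; rewrite ?tmul1t ?tmult1 ?big_seq1 ?d1 ?umul1r ?umulr1 //.
rewrite umul_Node tmul_Node ser_sumE big_cat !big_map /=.
rewrite (_ : (fun s => _ (Node l s)) = (l == l0)%:R *: delta r0); last first.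
  by apply/funext => s; rewrite delta_Nodel.
rewrite (_ : (fun s => _ (Node s r)) = (r == r1)%:R *: delta l1); last first.
  by apply/funext => s; rewrite delta_Noder.
rewrite (lin_scale (umul_linearl _)) (lin_scale (umul_linearr _)) !serZE IHl IHr.
rewrite !ser_sumE !mulr_sumr; congr (_ + _); apply: eq_bigr => u _.
  by rewrite delta_Nodel.
by rewrite delta_Noder.
Qed.

Lemma aug_ddelta t : aug (ddelta t) = delta (node t).
Proof. by case: t => l r; apply/funext => -[]. Qed.

Lemma uprec_delta a b :
  uprec (ddelta a) (delta b) = \sum_(u <- tmul a.2 b) ddelta (a.1, u).
Proof.
case: a => l0 r0; apply/funext => -[l r]; rewrite dser_sumE /uprec /=.
rewrite (_ : (fun s => _ (l, s)) = (l == l0)%:R *: delta r0); last first.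
  by apply/funext => s; rewrite serZE -delta_Nodel.
rewrite (lin_scale (umul_linearl _)) umul_delta serZE ser_sumE mulr_sumr.
by apply: eq_bigr => u _; rewrite -delta_Nodel.
Qed.

Lemma usucc_delta a b :
  usucc (delta a) (ddelta b) = \sum_(u <- tmul a b.1) ddelta (u, b.2).
Proof.
case: b => l0 r0; apply/funext => -[l r]; rewrite dser_sumE /usucc /=.
rewrite (_ : (fun s => _ (s, r)) = (r == r0)%:R *: delta l0); last first.
  by apply/funext => s; rewrite serZE -delta_Noder.
rewrite (lin_scale (umul_linearr _)) umul_delta serZE ser_sumE mulr_sumr.
by apply: eq_bigr => u _; rewrite -delta_Noder.
Qed.

Lemma dprec_ddelta a b :
  dprec (ddelta a) (ddelta b) = \sum_(u <- tmul a.2 (node b)) ddelta (a.1, u).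
Proof. by rewrite /dprec aug_ddelta uprec_delta. Qed.

Lemma dsucc_ddelta a b :
  dsucc (ddelta a) (ddelta b) = \sum_(u <- tmul (node a) b.1) ddelta (u, b.2).
Proof. by rewrite /dsucc aug_ddelta usucc_delta. Qed.

Definition bounded (n : nat) (F : dser) := forall t, (n < ddeg t)%N -> F t = 0.

Lemma boundedW m n F : (m <= n)%N -> bounded m F -> bounded n F.
Proof. by move=> mn bF t nt; apply/bF/(leq_ltn_trans mn). Qed.

Lemma bounded_lin n a F G : bounded n F -> bounded n G -> bounded n (a *: F + G).
Proof. by move=> bF bG t nt; rewrite dserDE dserZE bF // bG // mulr0 addr0. Qed.

Lemma bounded_prec m n F G : bounded m F -> bounded n G -> bounded (m + n) (dprec F G).
Proof.
move=> bF bG [l r] lt; rewrite /dprec /uprec /umul /= big1_seq // => -[p q] /andP[_].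
move=> /deg_cuts /= degr.
have [le_pm|lt_mp] := leqP (ddeg (l, p)) m; last by rewrite bF ?mul0r.
case: q degr => [|q1 q2] degr; rewrite /= ?mulr0 // bG ?mulr0 //.
rewrite ltnNge; apply/negP => le_qn.
have := leq_add le_pm le_qn; rewrite leqNgt => /negP; apply; apply: leq_trans lt _.
by rewrite /ddeg /= -degr addnA addSn.
Qed.

Lemma bounded_succ m n F G : bounded m F -> bounded n G -> bounded (m + n) (dsucc F G).
Proof.
move=> bF bG [l r] lt; rewrite /dsucc /usucc /umul /= big1_seq // => -[p q] /andP[_].
move=> /deg_cuts /= degl.
have [le_qn|lt_nq] := leqP (ddeg (q, r)) n; last by rewrite bG ?mulr0.
case: p degl => [|p1 p2] degl; rewrite /= ?mul0r // bF ?mul0r //.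
rewrite ltnNge; apply/negP => le_pm.
have := leq_add le_pm le_qn; rewrite leqNgt => /negP; apply; apply: leq_trans lt _.
by rewrite /ddeg /= -degl addnS addnA.
Qed.

Lemma bounded_decomp n F : bounded n F -> F = \sum_(s <- dtrees n) F s *: ddelta s.
Proof.
move=> bF; apply/funext => t; rewrite dser_sumE.
under eq_bigr do rewrite dserZE.
have [le_tn|lt_nt] := leqP (ddeg t) n.
  rewrite (bigD1_seq t) ?uniq_dtrees ?mem_dtrees //= big1 => [|s st].
    by rewrite addr0 /ddelta eqxx mulr1.
  by rewrite /ddelta eq_sym (negbTE st) mulr0.
rewrite bF // big1_seq // => s /andP[_]; rewrite mem_dtrees => le_sn.
by rewrite /ddelta; case: eqP => [ts|_]; rewrite ?mulr0 // bF ?mul0r // -ts.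
Qed.

Section Evaluation.
Variables (B : dendType K) (b : B).

Definition peval (n : nat) (F : dser) : B := \sum_(s <- dtrees n) F s *: monom b s.

Lemma peval_linear n : linear (peval n).
Proof.
move=> a F G; rewrite /peval scaler_sumr -big_split; apply: eq_bigr => s _ /=.
by rewrite scalerDl scalerA.
Qed.

Lemma peval_ddelta n s : (ddeg s <= n)%N -> peval n (ddelta s) = monom b s.
Proof.
move=> le_sn; rewrite /peval (bigD1_seq s) ?uniq_dtrees ?mem_dtrees //= big1 => [|t ts].
  by rewrite addr0 /ddelta eqxx scale1r.
by rewrite /ddelta (negbTE ts) scale0r.
Qed.

Lemma peval_stable m n F : bounded m F -> (m <= n)%N -> peval n F = peval m F.
Proof.
move=> bF le_mn; rewrite [in LHS](bounded_decomp bF) (lin_sum (peval_linear n)).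
apply: eq_big_seq => s; rewrite mem_dtrees => le_sm.
by rewrite (lin_scale (peval_linear n)) peval_ddelta // (leq_trans le_sm).
Qed.

Lemma peval_prec m n F G : bounded m F -> bounded m G -> (m + m <= n)%N ->
  peval n (dprec F G) = lprec (peval m F) (peval m G).
Proof.
move=> bF bG le_mn.
rewrite [in LHS](bounded_decomp bF) [in LHS](bounded_decomp bG).
rewrite (lin_sum (lt_linearl dser_dendriform _)) (lin_sum (peval_linear n)).
rewrite {3}/peval (lin_sum (lt_linearl (dendP B) _)); apply: eq_big_seq => s sm.
rewrite (lin_sum (lt_linearr dser_dendriform _)) (lin_sum (peval_linear n)).
rewrite /(peval m) (lin_sum (lt_linearr (dendP B) _)); apply: eq_big_seq => t tm.
move: sm tm; rewrite !mem_dtrees => sm tm.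
rewrite (lin_scale (lt_linearl dser_dendriform _)) (lin_scale (lt_linearr dser_dendriform _)).
rewrite (lin_scale (lt_linearl (dendP B) _)) (lin_scale (lt_linearr (dendP B) _)).
rewrite !(lin_scale (peval_linear n)) dprec_ddelta (lin_sum (peval_linear n)).
congr (_ *: (_ *: _)); rewrite -monom_prec; apply: eq_big_seq => u /deg_tmul degu.
rewrite peval_ddelta // (leq_trans _ le_mn) // (leq_trans _ (leq_add sm tm)) //.
by rewrite /ddeg /= degu /= addnA addSn.
Qed.

Lemma peval_succ m n F G : bounded m F -> bounded m G -> (m + m <= n)%N ->
  peval n (dsucc F G) = lsucc (peval m F) (peval m G).
Proof.
move=> bF bG le_mn.
rewrite [in LHS](bounded_decomp bF) [in LHS](bounded_decomp bG).
rewrite (lin_sum (gt_linearl dser_dendriform _)) (lin_sum (peval_linear n)).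
rewrite {3}/peval (lin_sum (gt_linearl (dendP B) _)); apply: eq_big_seq => s sm.
rewrite (lin_sum (gt_linearr dser_dendriform _)) (lin_sum (peval_linear n)).
rewrite /(peval m) (lin_sum (gt_linearr (dendP B) _)); apply: eq_big_seq => t tm.
move: sm tm; rewrite !mem_dtrees => sm tm.
rewrite (lin_scale (gt_linearl dser_dendriform _)) (lin_scale (gt_linearr dser_dendriform _)).
rewrite (lin_scale (gt_linearl (dendP B) _)) (lin_scale (gt_linearr (dendP B) _)).
rewrite !(lin_scale (peval_linear n)) dsucc_ddelta (lin_sum (peval_linear n)).
congr (_ *: (_ *: _)); rewrite -monom_succ; apply: eq_big_seq => u /deg_tmul degu.
rewrite peval_ddelta // (leq_trans _ le_mn) // (leq_trans _ (leq_add sm tm)) //.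
by rewrite /ddeg /= degu /= addnS addnA.
Qed.

End Evaluation.

(* As there are finitely many trees of each degree, these are the series with
   finitely many nonzero coefficients. *)

Definition finite_ser : {pred dser} := fun F => `[< exists n, bounded n F >].

Fact finite_ser_submod : submod_closed finite_ser.
Proof.
split=> [|a F G /asboolP[m bF] /asboolP[n bG]]; apply/asboolP; first by exists 0%N.
exists (m + n)%N; apply: bounded_lin; apply: boundedW; try exact: bF; try exact: bG.
  exact: leq_addr.
exact: leq_addl.
Qed.
HB.instance Definition _ := GRing.isSubmodClosed.Build K dser finite_ser finite_ser_submod.

Record fser := FSer { fval : dser; fvalP : fval \in finite_ser }.
HB.instance Definition _ := [isSub for fval].
HB.instance Definition _ := [Choice of fser by <:].
HB.instance Definition _ := [SubChoice_isSubLmodule of fser by <:].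

Fact finite_prec (F G : fser) : dprec (fval F) (fval G) \in finite_ser.
Proof.
case: F G => F /= /asboolP[m bF] [G /= /asboolP[n bG]].
by apply/asboolP; exists (m + n)%N; apply: bounded_prec.
Qed.

Fact finite_succ (F G : fser) : dsucc (fval F) (fval G) \in finite_ser.
Proof.
case: F G => F /= /asboolP[m bF] [G /= /asboolP[n bG]].
by apply/asboolP; exists (m + n)%N; apply: bounded_succ.
Qed.

Definition fprec (F G : fser) : fser := FSer (finite_prec F G).
Definition fsucc (F G : fser) : fser := FSer (finite_succ F G).

Lemma fval_linear : linear fval.
Proof. by []. Qed.

Lemma fser_dendriform : is_dendriform fprec fsucc.
Proof.
have D := dser_dendriform.
split=> [f a g h|g a f h|f a g h|g a f h|f g h|f g h|f g h]; apply: val_inj => /=;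
  rewrite ?fval_linear ?(lin_add fval_linear) /=.
- exact: (lt_linearr D).
- exact: (lt_linearl D).
- exact: (gt_linearr D).
- exact: (gt_linearl D).
- exact: (dend_ax1 D).
- exact: (dend_ax2 D).
- exact: (dend_ax3 D).
Qed.

Definition Dend : dendType K := DendType fser_dendriform.

Fact finite_ddelta t : ddelta t \in finite_ser.
Proof.
apply/asboolP; exists (ddeg t) => s lt; rewrite /ddelta.
by case: eqP lt => // ->; rewrite ltnn.
Qed.
Definition fdelta (t : dtree) : Dend := FSer (finite_ddelta t).
Definition Xfin : Dend := fdelta (Leaf, Leaf).

Definition oaug (o : option dser) : ser := if o is Some y then aug y else uone.

Lemma monom_dser (x : dendhat) t :
  monom x t = uprec (usucc (oaug (umonom x t.1)) x) (oaug (umonom x t.2)).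
Proof.
by rewrite /monom; case: (umonom x t.1) => [y|]; case: (umonom x t.2) => [y'|];
  rewrite /= ?uprec1 ?usucc1.
Qed.

Lemma monom_Xser t : monom (Xser : dendhat) t = ddelta t.
Proof.
have step l r : uprec (usucc (delta l) Xser) (delta r) = ddelta (l, r).
  by rewrite usucc_delta tmult1 big_seq1 uprec_delta tmul1t big_seq1.
have H s : oaug (umonom (Xser : dendhat) s) = delta s.
  elim: s => [|l IHl r IHr]; first by apply/funext => -[].
  rewrite -[oaug _]/(aug (monom (Xser : dendhat) (l, r))) monom_dser IHl IHr step.
  exact: aug_ddelta.
by case: t => l r; rewrite monom_dser !H step.
Qed.

Lemma fval_morphism : dend_morphism (fval : Dend -> dendhat).
Proof. by split. Qed.

Lemma monom_Xfin t : monom Xfin t = fdelta t.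
Proof. by apply: val_inj; rewrite /= (monom_morph _ _ fval_morphism) monom_Xser. Qed.

Theorem Dend_free (B : dendType K) (b : B) :
  exists f : Dend -> B, [/\ dend_morphism f, f Xfin = b
    & forall g : Dend -> B, dend_morphism g -> g Xfin = b -> g =1 f].
Proof.
have /boolp.choice[n bn] : forall F : Dend, exists n, bounded n (fval F).
  by move=> F; exact/asboolP/fvalP.
exists (fun F => peval b (n F) (fval F)).
have stable m (F : Dend) : bounded m (fval F) -> peval b (n F) (fval F) = peval b m (fval F).
  move=> bm; rewrite -(peval_stable b (bn F) (leq_addr m _)).
  by rewrite -(peval_stable b bm (leq_addl (n F) _)).
split=> [||g gM gX F].
- split=> [a F G|F G|F G].
  + have bF := boundedW (leq_addr (n G) (n F)) (bn F).
    have bG := boundedW (leq_addl (n F) (n G)) (bn G).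
    rewrite (stable _ (a *: F + G) (bounded_lin a bF bG)) (stable _ _ bF) (stable _ _ bG).
    exact: peval_linear.
  + have bF := boundedW (leq_addr (n G) (n F)) (bn F).
    have bG := boundedW (leq_addl (n F) (n G)) (bn G).
    rewrite (stable _ (lprec F G) (bounded_prec bF bG)) (stable _ _ bF) (stable _ _ bG).
    exact: peval_prec.
  + have bF := boundedW (leq_addr (n G) (n F)) (bn F).
    have bG := boundedW (leq_addl (n F) (n G)) (bn G).
    rewrite (stable _ (lsucc F G) (bounded_succ bF bG)) (stable _ _ bF) (stable _ _ bG).
    exact: peval_succ.
- have bX : bounded 1 (fval Xfin) by case=> [] [|? ?] [|? ?] // _; rewrite /ddelta.
  by rewrite (stable _ _ bX) peval_ddelta.
- have Fdec : F = \sum_(s <- dtrees (n F)) fval F s *: fdelta s :> Dend.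
    apply: val_inj; rewrite /= (lin_sum fval_linear) {1}(bounded_decomp (bn F)).
    by apply: eq_bigr => s _; rewrite (lin_scale fval_linear).
  rewrite [in LHS]Fdec (lin_sum (morph_linear gM)); apply: eq_bigr => s _.
  by rewrite (lin_scale (morph_linear gM)) -monom_Xfin (monom_morph _ _ gM) gX.
Qed.

(* Substitution: F(z) is the sum of F_s s(z) over all trees s; as s(z) has no
   term of degree < deg s, the trees s of degree > deg t do not contribute to the
   coefficient on t.  See dsubst_morphism, dsubst_X, dsubst_continuous and
   dsubst_unique. *)
Definition dsubst (F z : dser) : dser :=
  fun t => (\sum_(s <- dtrees (ddeg t)) F s *: monom (z : dendhat) s : dser) t.

(* Continuity, for additive maps, for the topology of the filtration by degree. *)
Definition deg_continuous (f : dser -> dser) :=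
  forall n, exists m, forall F, (forall t, (ddeg t <= m)%N -> F t = 0) ->
    forall t, (ddeg t <= n)%N -> f F t = 0.

Definition eq_upto (n : nat) (F G : dser) := forall t, (ddeg t <= n)%N -> F t = G t.

Lemma eq_upto_prec n F F' G G' : eq_upto n F F' -> eq_upto n G G' ->
  eq_upto n (dprec F G) (dprec F' G').
Proof.
move=> FF GG [l r] lt; apply: eq_big_seq => -[p q] /deg_cuts /= degr.
have rlt : (deg r <= n)%N by apply: leq_trans (ltnW _) lt; rewrite ltnS leq_addl.
rewrite FF ?(leq_trans _ lt) // /ddeg /= ?ltnS ?leq_add2l -?degr ?leq_addr //.
case: q degr => // q1 q2 degr; rewrite /= GG // (leq_trans _ rlt) //.
by rewrite -degr leq_addl.
Qed.

Lemma eq_upto_succ n F F' G G' : eq_upto n F F' -> eq_upto n G G' ->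
  eq_upto n (dsucc F G) (dsucc F' G').
Proof.
move=> FF GG [l r] lt; apply: eq_big_seq => -[p q] /deg_cuts /= degl.
have llt : (deg l <= n)%N by apply: leq_trans (ltnW _) lt; rewrite ltnS leq_addr.
rewrite GG ?(leq_trans _ lt) // /ddeg /= ?ltnS ?leq_add2r -?degl ?leq_addl //.
case: p degl => // p1 p2 degl; rewrite /= FF // (leq_trans _ llt) //.
by rewrite -degl leq_addr.
Qed.

Definition uorder (n : nat) (f : ser) := forall t, (deg t < n)%N -> f t = 0.
Definition dorder (n : nat) (F : dser) := forall t, (ddeg t < n)%N -> F t = 0.

Lemma uorder_aug n F : dorder n F -> uorder n (aug F).
Proof. by move=> oF [|l r] //; exact: (oF (l, r)). Qed.

Lemma dorder1 F : dorder 1 F. Proof. by []. Qed.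

Lemma order_uprec m n F g : dorder m F -> uorder n g -> dorder (m + n) (uprec F g).
Proof.
move=> oF og [l r] lt; rewrite /uprec /umul big1_seq // => -[p q] /andP[_] /deg_cuts /= degr.
have [le_mp|lt_pm] := leqP m (ddeg (l, p)); last by rewrite oF ?mul0r.
rewrite og ?mulr0 // ltnNge; apply/negP => le_nq.
have := leq_add le_mp le_nq; rewrite leqNgt => /negP; apply; apply: leq_trans lt.
by rewrite /ddeg /= -degr addnA addSn.
Qed.

Lemma order_usucc m n f G : uorder m f -> dorder n G -> dorder (m + n) (usucc f G).
Proof.
move=> of_ oG [l r] lt; rewrite /usucc /umul big1_seq // => -[p q] /andP[_] /deg_cuts /= degl.
have [le_nq|lt_qn] := leqP n (ddeg (q, r)); last by rewrite oG ?mulr0.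
rewrite of_ ?mul0r // ltnNge; apply/negP => le_mp.
have := leq_add le_mp le_nq; rewrite leqNgt => /negP; apply; apply: leq_trans lt.
by rewrite /ddeg /= -degl addnS addnA.
Qed.

Lemma uorder_umul m n f g : uorder m f -> uorder n g -> uorder (m + n) (umul f g).
Proof.
move=> of_ og t lt; rewrite /umul big1_seq // => -[p q] /andP[_] /deg_cuts /= degt.
have [le_mp|lt_pm] := leqP m (deg p); last by rewrite of_ ?mul0r.
rewrite og ?mulr0 // ltnNge; apply/negP => le_nq.
by have := leq_add le_mp le_nq; rewrite leqNgt degt lt.
Qed.

Lemma order_monom (z : dendhat) t : dorder (ddeg t) (monom z t).
Proof.
have step l r : uorder (deg l) (oaug (umonom z l)) ->
    uorder (deg r) (oaug (umonom z r)) -> dorder (ddeg (l, r)) (monom z (l, r)).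
  move=> ol or; rewrite monom_dser.
  rewrite (_ : ddeg (l, r) = (deg l + 1 + deg r)%N); last by rewrite addn1 addSn.
  by apply: order_uprec => //; apply: order_usucc.
have H s : uorder (deg s) (oaug (umonom z s)).
  by elim: s => // l IHl r IHr; apply/uorder_aug/step.
by case: t => l r; apply: step.
Qed.

Lemma dsubst_peval F z n t : (ddeg t <= n)%N -> dsubst F z t = peval (z : dendhat) n F t.
Proof.
move=> le_tn; rewrite /dsubst /peval !dser_sumE.
rewrite [RHS](bigID (fun s => s \in dtrees (ddeg t))) /= [X in _ + X]big1_seq ?addr0.
  rewrite -[RHS]big_filter; apply/perm_big/uniq_perm; [exact: uniq_dtrees | exact/filter_uniq/uniq_dtrees |].
  move=> s; rewrite [LHS]mem_dtrees [RHS]mem_filter !mem_dtrees.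
  by case: leqP => //= le_st; rewrite (leq_trans le_st).
move=> s /andP[]; rewrite (mem_dtrees (ddeg t)) -ltnNge => lt _.
by rewrite dserZE (@order_monom z s t lt) mulr0.
Qed.

Definition trunc (n : nat) (F : dser) : dser := fun t => if (ddeg t <= n)%N then F t else 0.

Lemma bounded_trunc n F : bounded n (trunc n F).
Proof. by move=> t nt; rewrite /trunc leqNgt nt. Qed.

Lemma eq_upto_trunc n F : eq_upto n F (trunc n F).
Proof. by move=> t tn; rewrite /trunc tn. Qed.

Lemma eq_upto_peval (B : dendType K) (b : B) n F G :
  eq_upto n F G -> peval b n F = peval b n G.
Proof. by move=> FG; apply: eq_big_seq => s; rewrite mem_dtrees => /FG->. Qed.

Lemma dsubst_linear z : linear (dsubst^~ z).
Proof.
move=> a F G; apply/funext => t.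
by rewrite dserDE dserZE !(dsubst_peval _ _ (leqnn _)) peval_linear.
Qed.

Lemma dsubst_morphism z : dend_morphism (dsubst^~ z : dendhat -> dendhat).
Proof.
split=> [|F G|F G]; first exact: dsubst_linear; apply/funext => t; set n := ddeg t.
  have cF H : eq_upto n (dsubst H z) (peval (z : dendhat) n (trunc n H)).
    by move=> s sn; rewrite (dsubst_peval _ _ sn) (eq_upto_peval _ (@eq_upto_trunc n H)).
  rewrite [RHS](eq_upto_prec (cF F) (cF G)) //.
  transitivity (peval (z : dendhat) (n + n) (dprec (trunc n F) (trunc n G)) t);
    last by rewrite (peval_prec _ (@bounded_trunc n F) (@bounded_trunc n G) (leqnn _)).
  rewrite -(dsubst_peval _ _ (leq_addr _ _)) !(dsubst_peval _ _ (leqnn n)).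
  congr (_ t); apply: (@eq_upto_peval dendhat).
  by apply: eq_upto_prec; exact: eq_upto_trunc.
have cF H : eq_upto n (dsubst H z) (peval (z : dendhat) n (trunc n H)).
  by move=> s sn; rewrite (dsubst_peval _ _ sn) (eq_upto_peval _ (@eq_upto_trunc n H)).
rewrite [RHS](eq_upto_succ (cF F) (cF G)) //.
transitivity (peval (z : dendhat) (n + n) (dsucc (trunc n F) (trunc n G)) t);
  last by rewrite (peval_succ _ (@bounded_trunc n F) (@bounded_trunc n G) (leqnn _)).
rewrite -(dsubst_peval _ _ (leq_addr _ _)) !(dsubst_peval _ _ (leqnn n)).
congr (_ t); apply: (@eq_upto_peval dendhat).
by apply: eq_upto_succ; exact: eq_upto_trunc.
Qed.

Lemma dsubst_X z : dsubst Xser z = z.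
Proof.
by apply/funext => t; rewrite (dsubst_peval _ _ (leqnn _)) peval_ddelta.
Qed.

Lemma dsubst_continuous z : deg_continuous (dsubst^~ z).
Proof.
move=> n; exists n => F F0 t tn; rewrite (dsubst_peval _ _ tn).
by rewrite /peval dser_sumE big1_seq // => s /andP[_]; rewrite mem_dtrees dserZE => /F0->; rewrite mul0r.
Qed.

(* F |-> F(z) is the only continuous dendriform endomorphism mapping x to z. *)
Theorem dsubst_unique z (f : dendhat -> dendhat) :
  dend_morphism f -> deg_continuous f -> f Xser = z -> forall F, f F = dsubst F z.
Proof.
move=> fM fC fX F; apply/funext => t; have [m fm] := fC (ddeg t).
pose n := (m + ddeg t)%N.
have -> : F = (F - trunc n F) + trunc n F by rewrite subrK.
rewrite (lin_add (morph_linear fM)) dserDE fm // ?add0r; last first.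
  move=> s sm; rewrite -[LHS]/(F s - trunc n F s) -eq_upto_trunc ?subrr //.
  exact: leq_trans sm (leq_addr _ _).
rewrite subrK (bounded_decomp (@bounded_trunc n F)) (lin_sum (morph_linear fM)).
rewrite (dsubst_peval _ _ (leq_addl m _)) (eq_upto_peval _ (@eq_upto_trunc n F)).
congr (_ t); apply: eq_bigr => s _.
by rewrite (lin_scale (morph_linear fM)) -monom_Xser (monom_morph _ _ fM) fX.
Qed.

Lemma usumE (u : nat -> ser) N t : (forall n, uorder n (u n)) -> (deg t < N)%N ->
  (\sum_(0 <= n < N) u n) t = usum u t.
Proof.
move=> ou lt; rewrite ser_sumE /usum (big_cat_nat (leq0n _) lt) //= [X in _ + X]big1_seq ?addr0 //.
by move=> i /andP[_]; rewrite mem_index_iota => /andP[ti _]; exact: ou.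
Qed.

Lemma dsumE (u : nat -> dser) N t : (forall n, dorder n (u n)) -> (ddeg t < N)%N ->
  (\sum_(1 <= n < N) u n) t = dsum u t.
Proof.
move=> ou lt; rewrite dser_sumE /dsum (big_cat_nat _ lt) //= [X in _ + X]big1_seq ?addr0 //.
by move=> i /andP[_]; rewrite mem_index_iota => /andP[ti _]; exact: ou.
Qed.

Lemma uorder_upow F n : uorder n (upow (aug F) n).
Proof. by elim: n => // n IHn; rewrite -add1n; apply: uorder_umul => //; apply: uorder_aug. Qed.

Lemma order_lpow F n : dorder n (lpow F n).
Proof.
case: n => // n; rewrite /lpow /=; elim: n => // n IHn.
by rewrite -add1n; apply: order_uprec => //; apply: uorder_aug.
Qed.

End Series.

(* Main.v *)
(* Write e(z) = 1 + E(z). Then E(z) = z < e(z), and L(z) < (1 + z) = z because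
   the alternating series of powers inverts 1 + z for the associative product.
   Hence L(E(x)) < e(x) = E(x) = x < e(x), and right multiplication by 1 plus a
   series without constant term is injective, so L(E(x)) = x.  Similarly x and
   E(L(x)) are both solutions G of the equation G = L(x) < (1 + G), which has at
   most one solution: iterating D = L(x) < D raises the order of D. *)

Require Import Defs.
From mathcomp Require Import all_boot all_order all_algebra.
From mathcomp Require Import boolp functions.

Set Implicit Arguments.
Unset Strict Implicit.
Unset Printing Implicit Defensive.

Import GRing.Theory.
Local Open Scope ring_scope.

Section CompositionInverse.
Variable K : comPzRingType.
Implicit Types (D F G : dser K) (f g : ser K).

Local Notation addone F := (uone K + aug F).

Lemma dorder_eq0 F : (forall n, dorder n F) -> F = 0.
Proof. by move=> oF; apply/funext => t; exact: (oF (ddeg t).+1). Qed.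

(** Since [F] starts in degree 1, an order [n] for [D] improves to [n.+1]. *)
Lemma eq_dprec_eq0 F D : D = dprec F D -> D = 0.
Proof.
move=> DE; apply: dorder_eq0; elim=> // n IHn.
by rewrite DE -add1n; apply: order_uprec => //; apply: uorder_aug.
Qed.

Lemma eq_opp_dprec_eq0 D F : D = - dprec D F -> D = 0.
Proof.
move=> DE; apply: dorder_eq0; elim=> // n IHn t lt.
have o : dorder (n + 1) (dprec D F) by apply: order_uprec => //; exact: uorder_aug.
by rewrite DE -[LHS]/(- (dprec D F t)) o ?oppr0 // addn1.
Qed.

Lemma uprec_addone F G : uprec F (addone G) = F + dprec F G.
Proof. by rewrite (lin_add (uprec_linearr F)) uprec1. Qed.

Lemma uprec_addone_inj G : injective (fun F => uprec F (addone G)).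
Proof.
move=> F F' /eqP; rewrite -subr_eq0 => /eqP FF'; apply/eqP; rewrite -subr_eq0; apply/eqP.
apply: (@eq_opp_dprec_eq0 _ G); apply/eqP; rewrite -addr_eq0 -uprec_addone -FF'.
by rewrite (lin_add (uprec_linearl _)) -scaleN1r (lin_scale (uprec_linearl _)) scaleN1r.
Qed.

Lemma uprec_addone_fix F G G' :
  G = uprec F (addone G) -> G' = uprec F (addone G') -> G = G'.
Proof.
move=> GE G'E; apply/eqP; rewrite -subr_eq0; apply/eqP/(@eq_dprec_eq0 F).
rewrite {1}GE {1}G'E !uprec_addone opprD addrACA subrr add0r -[- G']scaleN1r.
by rewrite (lin_add (dprec_linearr F)) (lin_scale (dprec_linearr F)) scaleN1r.
Qed.

Lemma eq_umull f f' g t :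
  (forall s, (deg s <= deg t)%N -> f s = f' s) -> umul f g t = umul f' g t.
Proof.
by move=> ff'; apply: eq_big_seq => p /deg_cuts degp; rewrite ff' // -degp leq_addr.
Qed.

Lemma upowSr f n : umul (upow f n) f = upow f n.+1.
Proof.
elim: n => [|n IHn]; first by rewrite /upow /= umul1r umulr1.
by rewrite [upow f n.+1]iterS -umulA IHn.
Qed.

(** The product telescopes: the n-th term times 1 + F is [u n - u n.+1]. *)
Lemma umul_alternating F :
  umul (usum (fun n => (-1) ^+ n *: upow (aug F) n)) (addone F) = uone K.
Proof.
set u := fun n => _.
have ou n : uorder n (u n) by move=> t lt; rewrite /u serZE uorder_upow // mulr0.
(* With this [N], the terms below [N] determine the coefficient at [t], and the remainder [u N]
   vanishes there. *)
apply/funext => t; pose N := (deg t).+1.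
rewrite (@eq_umull _ (\sum_(0 <= n < N) u n)); last first.
  by move=> s le_st; rewrite usumE.
rewrite (lin_sum (umul_linearl _)).
have uS n : umul (u n) (addone F) = - (u n.+1 - u n).
  rewrite (lin_add (umul_linearr _)) umulr1 opprB; congr (_ + _).
  by rewrite /u (lin_scale (umul_linearl _)) upowSr exprS mulN1r scaleNr opprK.
under eq_bigr do rewrite uS.
rewrite sumrN telescope_sumr // opprB -[LHS]/(u 0%N t - u N t) (ou N) // subr0.
by rewrite /u expr0 scale1r.
Qed.

Lemma uprec_Lser : uprec (Lser K) (addone (Xser K)) = Xser K.
Proof. by rewrite uprecA umul_alternating uprec1. Qed.

Lemma Eser_fix : Eser K = uprec (Xser K) (addone (Eser K)).
Proof.
rewrite uprec_addone; apply/funext => t; have oX := @order_lpow K (Xser K).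
(* Splitting off x shifts the index, so one extra term is kept for the rest to be exact up to degree
   [ddeg t]. *)
rewrite /Eser -(@dsumE _ _ (ddeg t).+2) // big_nat_recl // !dserDE; congr (_ + _).
pose S : dser K := \sum_(1 <= n < (ddeg t).+1) lpow (Xser K) n.
have -> : dprec (Xser K) (dsum (lpow (Xser K))) t = dprec (Xser K) S t.
  apply: (@eq_upto_prec K (ddeg t)) => // s le_st.
  by rewrite /S dsumE.
congr (_ t); rewrite /S (lin_sum (dprec_linearr _)).
(* The recursion for [lpow] fails at index 0, which the range excludes. *)
by apply: eq_big_nat => -[].
Qed.

(** Substitution acts only on series without unit, so the product is first expanded as F + F < G. *)
Lemma dsubst_uprec_addone F G z :
  dsubst (uprec F (addone G)) z = uprec (dsubst F z) (addone (dsubst G z)).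
Proof.
by rewrite !uprec_addone (lin_add (dsubst_linear z)) (morph_prec (dsubst_morphism z)).
Qed.

Lemma dsubst_Eser z : dsubst (Eser K) z = uprec z (addone (dsubst (Eser K) z)).
Proof. by rewrite {1}Eser_fix dsubst_uprec_addone dsubst_X. Qed.

Lemma uprec_dsubst_Lser z : uprec (dsubst (Lser K) z) (addone z) = z.
Proof. by rewrite -{2}[z]dsubst_X -dsubst_uprec_addone uprec_Lser dsubst_X. Qed.

End CompositionInverse.

Theorem proposition2p3 (K : comPzRingType) :
  dsubst (Eser K) (Lser K) = Xser K /\ dsubst (Lser K) (Eser K) = Xser K.
Proof.
split.
  (* Both E(L(x)) and x solve G = L(x) < (1 + G). *)
  by apply: uprec_addone_fix (dsubst_Eser _) _; rewrite uprec_Lser.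
by apply: (@uprec_addone_inj _ (Eser K)); rewrite uprec_dsubst_Lser -Eser_fix.
Qed.
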